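(* Let $L$ and $L'$ be loops. If $L\cong L'$, then $H(L)\cong H(L')$.
   Context: Mappings are written on the right, so $\alpha\beta$ means first $\alpha$, then $\beta$. For a loop $(L,\cdot)$ let $Aum(L,\cdot)$ be its automorphism group. The holomorph $H(L)=(H,\circ)$ is the loop on the set $H$ of pairs $(\alpha,x)$ with $\alpha\in Aum(L,\cdot)$, $x\in L$, with operation $(\alpha,x)\circ(\beta,y)=(\alpha\beta,\ x\beta\cdot y)$. *)

(* Defs.v *)
From HB Require Import structures.
From mathcomp Require Import all_boot.
From Stdlib Require Import FunctionalExtensionality ProofIrrelevance.
Set Implicit Arguments.
Unset Strict Implicit.
Unset Printing Implicit Defensive.

Local Open Scope group_scope.

(* The unit laws are repeated here because the library packages them only in
   [umagmaType], which also requires a [choiceType]; the carrier of a loop is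
   an arbitrary type. *)
HB.mixin Record BaseUMagma_isLoop G of BaseUMagma G := {
  loop_mul1g : left_id (1 : G) *%g;
  loop_mulg1 : right_id (1 : G) *%g;
  loop_ldiv : forall a b : G, exists! x : G, a * x = b;
  loop_rdiv : forall a b : G, exists! y : G, y * a = b
}.

#[short(type="loopType")]
HB.structure Definition Loop := {G of BaseUMagma_isLoop G & BaseUMagma G}.

Definition loop_iso (L L' : loopType) (f : L -> L') : Prop :=
  bijective f /\ {morph f : x y / x * y}.

Definition loop_isomorphic (L L' : loopType) : Prop :=
  exists f : L -> L', loop_iso f.

Record Aum (L : loopType) := MkAum {
  aum_val :> L -> L;
  aumP : loop_iso aum_val
}.

Section AumTheory.
Variable L : loopType.
Implicit Types a b : Aum L.

Lemma aum_ext a b : a =1 b -> a = b.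
Proof.
case: a b => [f hf] [g hg] /= /functional_extensionality fg.
by move: hf; rewrite fg => hf; congr MkAum; apply: proof_irrelevance.
Qed.

Lemma aum_id_subproof : loop_iso (@id L).
Proof. by split=> //; exists id. Qed.

Definition aum_id : Aum L := MkAum aum_id_subproof.

Lemma aum_comp_subproof a b : loop_iso (b \o a).
Proof.
case: a b => [f [bf mf]] [g [bg mg]] /=; split; first exact: bij_comp.
by move=> x y; rewrite /= mf mg.
Qed.

(* Mappings act on the right: the product [aum_comp a b] applies [a] first. *)
Definition aum_comp a b : Aum L := MkAum (aum_comp_subproof a b).

Lemma aum_inv a : exists b, cancel a b /\ cancel b a.
Proof.
case: (aumP a) => [[g fK gK] mf].
have hg : loop_iso g.
  split; first by exists a.
  by move=> x y; rewrite -{1}(gK x) -{1}(gK y) -mf fK.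
by exists (MkAum hg).
Qed.

End AumTheory.

Definition holomorph (L : loopType) : Type := (Aum L * L)%type.

Section Holomorph.
Variable L : loopType.
Implicit Types p q : holomorph L.

Definition hol_mul p q : holomorph L :=
  (aum_comp p.1 q.1, q.1 p.2 * q.2).

Definition hol_one : holomorph L := (aum_id L, 1).

Lemma aum1 (a : Aum L) : a 1 = 1.
Proof.
case: (aumP a) => _ mf; have [y [_ uy]] := loop_ldiv (a 1) (a 1).
by rewrite -(uy (a 1)) -?mf ?loop_mul1g // (uy 1) // loop_mulg1.
Qed.

Lemma hol_mul1 : left_id hol_one hol_mul.
Proof.
by case=> a x; congr pair; [exact: aum_ext | rewrite /= aum1 loop_mul1g].
Qed.

Lemma hol_mulr1 : right_id hol_one hol_mul.
Proof. by case=> a x; congr pair; [exact: aum_ext | rewrite /= loop_mulg1]. Qed.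

Lemma hol_ldiv p r : exists! q, hol_mul p q = r.
Proof.
case: p r => [a x] [c z]; have [a' [aK a'K]] := aum_inv a.
have [y [yz uy]] := loop_ldiv (aum_comp a' c x) z.
exists (aum_comp a' c, y); split=> [|[b w]].
  by congr pair; first by apply: aum_ext => t /=; rewrite aK.
case=> cE bw; have eb : aum_comp a' c = b.
  by rewrite -cE; apply: aum_ext => t /=; rewrite a'K.
congr pair; rewrite ?eb //; apply: uy.
by rewrite eb.
Qed.

Lemma hol_rdiv p r : exists! q, hol_mul q p = r.
Proof.
case: p r => [a x] [c z]; have [a' [aK a'K]] := aum_inv a.
have [y [yz uy]] := loop_rdiv x z.
exists (aum_comp c a', a' y); split=> [|[b w]].
  by congr pair; [apply: aum_ext => t /= | ]; rewrite /= a'K.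
case=> <- bw; congr pair; first by apply: aum_ext => t /=; rewrite aK.
by rewrite (uy (a w)).
Qed.

HB.instance Definition _ := hasMul.Build (holomorph L) hol_mul.
HB.instance Definition _ := hasOne.Build (holomorph L) hol_one.
HB.instance Definition _ := BaseUMagma_isLoop.Build (holomorph L)
  hol_mul1 hol_mulr1 hol_ldiv hol_rdiv.

End Holomorph.

(* Main.v *)
Require Import Defs.
From mathcomp Require Import all_boot.

(** Isomorphic loops have isomorphic holomorphs because the holomorph is built
    functorially from the loop: an isomorphism [f : L -> L'] carries an
    automorphism [a] of [L] to its conjugate [f^-1 a f] (maps acting on the
    right), and [(a, x) |-> (f^-1 a f, x f)] is the required isomorphism.  On
    first components it is multiplicative because the inner [f f^-1] cancels in
    [(f^-1 a f)(f^-1 b f)]; on second components because [f] is a morphism and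
    [(x f)(f^-1 b f) = (x b) f].  Conjugation by [f^-1] gives the inverse map,
    so it is enough to know that loop isomorphisms can be composed and
    inverted. *)

Set Implicit Arguments.
Unset Strict Implicit.
Unset Printing Implicit Defensive.

Local Open Scope group_scope.

Lemma loop_iso_comp (L1 L2 L3 : loopType) (f : L1 -> L2) (g : L2 -> L3) :
  loop_iso f -> loop_iso g -> loop_iso (g \o f).
Proof.
move=> [bf mf] [bg mg]; split; first exact: bij_comp.
by move=> x y; rewrite /= mf mg.
Qed.

Lemma loop_iso_can (L L' : loopType) (f : L -> L') (g : L' -> L) :
  loop_iso f -> cancel f g -> cancel g f -> loop_iso g.
Proof.
move=> [_ mf] fK gK; split; first by exists f.
by move=> x y; rewrite -{1}(gK x) -{1}(gK y) -mf fK.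
Qed.

Section HolomorphMap.
Variables (L L' : loopType) (f : L -> L') (g : L' -> L).
Hypotheses (f_iso : loop_iso f) (g_iso : loop_iso g).

(** The inverse [g] is an explicit parameter, so that the inverse of this map
    is the same construction with [f] and [g] exchanged. *)
Definition aum_conj (a : Aum L) : Aum L' :=
  MkAum (loop_iso_comp g_iso (loop_iso_comp (aumP a) f_iso)).

Definition holomorph_map (p : holomorph L) : holomorph L' :=
  (aum_conj p.1, f p.2).

Lemma holomorph_mapM :
  cancel f g -> {morph holomorph_map : p q / p * q}.
Proof.
move=> fK [a x] [b y]; have [_ mf] := f_iso.
by congr pair; [apply: aum_ext => t | ]; rewrite /= ?mf fK.
Qed.

End HolomorphMap.

Lemma holomorph_mapK (L L' : loopType) (f : L -> L') (g : L' -> L)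
    (f_iso : loop_iso f) (g_iso : loop_iso g) :
  cancel f g -> cancel (holomorph_map f_iso g_iso) (holomorph_map g_iso f_iso).
Proof.
move=> fK [a x]; congr pair; last exact: fK.
by apply: aum_ext => t; rewrite /= !fK.
Qed.

Theorem theorem3p3 (L L' : loopType) :
  loop_isomorphic L L' -> loop_isomorphic (holomorph L) (holomorph L').
Proof.
case=> f f_iso; have [[g fK gK] _] := f_iso.
have g_iso := loop_iso_can f_iso fK gK.
exists (holomorph_map f_iso g_iso); split; last exact: holomorph_mapM.
by exists (holomorph_map g_iso f_iso); exact: holomorph_mapK.
Qed.
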